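(* Consider the parallel Schwarz method with impedance transmission conditions for the two-dimensional transverse electric Maxwell wave-guide problem described in the context. For all $k>0$, $\sigma>0$, $\delta>0$ and $L>0$ we have that $R_{1d}^{\mathrm M}(\tilde k)<1$ for all evanescent modes $\tilde k>k$. Furthermore, under the assumption that between them $\sigma$, $\delta$ and $L$ are sufficiently large we have that $R_{2d}^{\mathrm M}<1$. In particular, this is true when $\sigma\ge k$ for all $\delta>0$ and $L>0$. Therefore the convergence will ultimately be independent of the number of subdomains (we say that the Schwarz method will scale).
   Context: Domain $\Omega=(a_1,b_N)\times(0,\hat L)$, with $\hat L>0$, decomposed into $N$ overlapping subdomains $\Omega_j=(a_j,b_j)\times(0,\hat L)$, $j=1,\dots,N$, with $b_j-a_j=L+2\delta$, $b_{j-1}-a_j=2\delta$, $a_{j+1}-a_j=b_{j+1}-b_j=L$. The problem for $\mathbf{E}=(E_x,E_y)$ is $\mathcal{L}\mathbf{E}:=-k^2\mathbf{E}+\nabla\times(\nabla\times\mathbf{E})+ik\sigma\mathbf{E}=\mathbf{0}$, i.e. $-k^2E_x-\partial_{yy}E_x+\partial_{xy}E_y+ik\sigma E_x=0$ and $-k^2E_y-\partial_{xx}E_y+\partial_{xy}E_x+ik\sigma E_y=0$, with $E_x=0$ for $y\in\{0,\hat L\}$, $\mathcal{B}_l\mathbf{E}:=(-\partial_x+ik)E_y+\partial_yE_x=g_1$ at $x=a_1$ and $\mathcal{B}_r\mathbf{E}:=(\partial_x+ik)E_y-\partial_yE_x=-g_2$ at $x=b_N$. The parallel Schwarz method solves $\mathcal{L}\mathbf{E}_j^n=\mathbf{0}$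 in $\Omega_j$ with $\mathcal{B}_l\mathbf{E}_j^n=\mathcal{B}_l\mathbf{E}_{j-1}^{n-1}$ at $x=a_j$, $\mathcal{B}_r\mathbf{E}_j^n=\mathcal{B}_r\mathbf{E}_{j+1}^{n-1}$ at $x=b_j$ (with the given boundary data at $x=a_1$ for $j=1$ and $x=b_N$ for $j=N$) and $E_{x,j}^n=0$ for $y\in\{0,\hat L\}$. The local errors are expanded as $e_{x,j}^n=\sum_{m\ge1}v_j^n(x,\tilde k)\sin(\tilde ky)$, $e_{y,j}^n=\sum_{m\ge1}w_j^n(x,\tilde k)\cos(\tilde ky)$ with Fourier numbers $\tilde k=\frac{m\pi}{\hat L}$, $m\in\{1,2,\dots\}$. Each mode evolves independently and reduces to a one-dimensional Schwarz iteration for the equation $(ik\sigma+\tilde k^2-k^2)u-\partial_{xx}u=0$ with interface operators $-\partial_x+\alpha$ (at $x=a_j$) and $\partial_x+\alpha$ (at $x=b_j$), $\alpha=ik+\sigma$, whose interface data are multiplied at each iteration by the matrix $\mathcal{T}_{1d}^{\mathrm M}(\tilde k)$. Here $\mathcal{T}_{1d}^{\mathrm M}(\tilde k)\in\mathbb{C}^{2(N-1)\times2(N-1)}$ is the block tridiagonal block Toeplitz matrix with $2\times2$ blocks: diagonal blocks $A_0=\begin{bmatrix}0&b\\ b&0\end{bmatrix}$, first superdiagonal blocks $A_1=\begin{bmatrix}a&0\\0&0\end{bmatrix}$, first subdiagonal blocks $A_{-1}=\begin{bmatrix}0&0\\0&a\end{bmatrix}$, where $$a=\frac{(\zeta+\alpha)^2e^{2\zeta\delta}-(\zeta-\alpha)^2e^{-2\zeta\delta}}{(\zeta+\alpha)^2e^{\zeta(2\delta+L)}-(\zeta-\alpha)^2e^{-\zeta(2\delta+L)}},\qquad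 b=-\frac{(\zeta^2-\alpha^2)(e^{\zeta L}-e^{-\zeta L})}{(\zeta+\alpha)^2e^{\zeta(2\delta+L)}-(\zeta-\alpha)^2e^{-\zeta(2\delta+L)}},$$ with $\alpha=ik+\sigma$ and $\zeta=\zeta(\tilde k)=\sqrt{ik\sigma+\tilde k^2-k^2}$ (principal square root). With $\rho$ the spectral radius, $R_{1d}^{\mathrm M}(\tilde k):=\lim_{N\to\infty}\rho(\mathcal{T}_{1d}^{\mathrm M}(\tilde k))$ and $R_{2d}^{\mathrm M}:=\sup_{\tilde k}R_{1d}^{\mathrm M}(\tilde k)$, the supremum being over all $\tilde k=\frac{m\pi}{\hat L}$, $m\ge1$. *)

(* Defs.v *)
From HB Require Import structures.
From mathcomp Require Import all_boot all_order all_algebra.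
From mathcomp Require Import all_classical all_reals all_analysis.
From mathcomp Require Import complex.

Set Implicit Arguments.
Unset Strict Implicit.
Unset Printing Implicit Defensive.

Import Order.TTheory GRing.Theory Num.Theory.
Import numFieldNormedType.Exports.

Local Open Scope classical_set_scope.
Local Open Scope complex_scope.
Local Open Scope ring_scope.

Definition cexp (R : realType) (z : R[i]) : R[i] :=
  (expR (complex.Re z))%:C * (cos (complex.Im z) +i* sin (complex.Im z)).

(* The supremum is over a finite set, hence a maximum; it is 0 for the empty
   matrix. *)
Definition spectral_radius (R : realType) (n : nat) (A : 'M[R[i]]_n) : R :=
  sup [set ComplexField.Normc.normc l | l in [set l : R[i] | eigenvalue A l]].

Section Maxwell.
Variable R : realType.
Implicit Types (k sigma delta L Lhat kt : R) (m N : nat).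

Definition fourier_number Lhat m : R := m%:R * pi / Lhat.

Definition alpha k sigma : R[i] := sigma +i* k.

(* [sqrtc] is the principal square root: its real part is nonnegative. *)
Definition zeta k sigma kt : R[i] :=
  sqrtc ((kt ^+ 2 - k ^+ 2) +i* (k * sigma)).

(* The common denominator of [coef_a] and [coef_b]. *)
Definition coef_den k sigma delta L kt : R[i] :=
  let z := zeta k sigma kt in let al := alpha k sigma in
  (z + al) ^+ 2 * cexp (z * (2 * delta + L)%:C)
  - (z - al) ^+ 2 * cexp (- (z * (2 * delta + L)%:C)).

Definition coef_a k sigma delta L kt : R[i] :=
  let z := zeta k sigma kt in let al := alpha k sigma in
  ((z + al) ^+ 2 * cexp (z * (2 * delta)%:C)
   - (z - al) ^+ 2 * cexp (- (z * (2 * delta)%:C)))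
  / coef_den k sigma delta L kt.

Definition coef_b k sigma delta L kt : R[i] :=
  let z := zeta k sigma kt in let al := alpha k sigma in
  - ((z ^+ 2 - al ^+ 2) * (cexp (z * L%:C) - cexp (- (z * L%:C)))
     / coef_den k sigma delta L kt).

(* [N] is the number of subdomains; there are [N - 1] block rows. *)
Definition T1d k sigma delta L kt N : 'M[R[i]]_(\sum_(i < N.-1) 2) :=
  let a := coef_a k sigma delta L kt in
  let b := coef_b k sigma delta L kt in
  let A0 : 'M[R[i]]_2 := b *: (delta_mx 0 1 + delta_mx 1 0) in
  let A1 : 'M[R[i]]_2 := a *: delta_mx 0 0 in
  let Am1 : 'M[R[i]]_2 := a *: delta_mx 1 1 in
  \mxblock_(i < N.-1, j < N.-1)
    (if j == i :> nat then A0
     else if j == i.+1 :> nat then A1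
     else if i == j.+1 :> nat then Am1
     else 0).

Definition rho1d k sigma delta L kt : R^nat :=
  fun N => spectral_radius (T1d k sigma delta L kt N).

(* Only meaningful when the sequence [rho1d k sigma delta L kt] converges. *)
Definition R1d k sigma delta L kt : R := limn (rho1d k sigma delta L kt).

(* The supremum is taken in the extended reals, so that an unbounded family of
   mode-wise factors has supremum +oo. *)
Definition R2d k sigma delta L Lhat : \bar R :=
  ereal_sup [set (R1d k sigma delta L (fourier_number Lhat m))%:E
            | m in [set m | (0 < m)%N]].

(* For all large enough numbers of subdomains, the convergence factor is bounded
   below 1, uniformly in the number of subdomains and in the mode. *)
Definition schwarz_scales k sigma delta L Lhat : Prop :=
  exists2 r : R, r < 1 &
    exists N0 : nat, forall N m, (N0 <= N)%N -> (0 < m)%N ->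
      rho1d k sigma delta L (fourier_number Lhat m) N <= r.

End Maxwell.

(* Main.v *)
Require Import Defs.
From HB Require Import structures.
From mathcomp Require Import all_boot all_order all_algebra.
From mathcomp Require Import all_classical all_reals all_analysis.
From mathcomp Require Import complex.
From mathcomp Require Import ring lra zify.

Set Implicit Arguments.
Unset Strict Implicit.
Unset Printing Implicit Defensive.

Import Order.TTheory GRing.Theory Num.Theory.
Import numFieldNormedType.Exports.

Local Open Scope classical_set_scope.
Local Open Scope complex_scope.
Local Open Scope ring_scope.

(** The iteration matrix is block Toeplitz with two scalar parameters a and b,
    and everything reduces to the single number
    [M = max (|a + b|, |a - b|)] (called [mode_factor] for a Fourier mode).

    Upper bound. The matrix sends the pair formed by the second entry of a block
    and the first entry of the next block to a pair of the same kind, through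
    the matrix with rows (b, a) and (a, b); only the two boundary pairs are
    truncated. The operator norm of that 2 x 2 matrix is M, so every eigenvalue
    has modulus at most M, whatever the number of subdomains
    ([eigenvalue_toeplitz_le]).

    Lower bound. When a and b are nonzero, the nonzero eigenvalues include the
    nonzero roots of a polynomial [chi] given by a three-term recursion
    ([root_chi_eigenvalue]). At [l = a + c] with [c = b] or [c = - b] the
    recursion has a double characteristic root, hence [chi] and its derivative
    have closed forms there, of orders n and n^3 up to a common factor
    ([chi_double_point]). Since a polynomial with N roots, all at distance at
    least d from l, satisfies [|p'(l)| d <= N |p(l)|] ([nearest_root]), some
    root lies within O(1/n) of l. Choosing the sign for which [|a + c| = M]
    shows that the spectral radius tends to M
    ([cvg_spectral_radius_toeplitz]); hence R1d is M, and M also bounds the spectral radius for every N, which is what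
    makes the method scale.

    Modes. With z = x + i y the root zeta, u = z + alpha and v = z - alpha, the
    numbers a + b and a - b factor as quotients of one function
    [u exp (z t) -/+ v exp (- z t)] at [t = delta - L / 2] and
    [t = delta + L / 2] ([coef_addE], [coef_subE]). The difference of the
    squared moduli at the two points is explicit ([wave_gap]): a hyperbolic term
    minus a trigonometric one. The bounds sinh w >= w and |sin w| <= w compare
    them. The trigonometric part with factor [k x - sigma y] is always
    dominated, because [x (x sigma + y k) > y |k x - sigma y|] follows from
    [kt <> 0]. The part with factor [|zeta|^2 - |alpha|^2] is dominated when
    [k^2 - kt^2 <= sigma^2], which covers evanescent modes as well as
    [sigma >= k], or when [2 x^2 L delta >= 1], which is implied by any one of
    the parameters being large ([damped], [damped_gap], [uniformly_damped]).
    Finally x grows with the mode number, so the factor is below 1/2 for all but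
    finitely many modes, and pointwise bounds give a supremum below 1
    ([R2d_lt1]). *)

Import ComplexField.
Local Notation normc := ComplexField.Normc.normc.

(** * The block Toeplitz matrix and the bound on its eigenvalues *)

(** The iteration matrix with its two coefficients as free parameters: the
    spectral limit does not depend on where they come from. *)
Definition toeplitz (R : realType) (a b : R[i]) n : 'M[R[i]]_(\sum_(i < n) 2) :=
  \mxblock_(i < n, j < n)
    (if j == i :> nat then b *: (delta_mx 0 1 + delta_mx 1 0)
     else if j == i.+1 :> nat then a *: delta_mx 0 0
     else if i == j.+1 :> nat then a *: delta_mx 1 1
     else 0).

Lemma T1dE (R : realType) (k sigma delta L kt : R) N :
  T1d k sigma delta L kt N =
  toeplitz (coef_a k sigma delta L kt) (coef_b k sigma delta L kt) N.-1.
Proof. by []. Qed.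

Definition row2 (K : pzRingType) (x y : K) : 'rV[K]_2 :=
  \row_(e < 2) (if e == 0 then x else y).

Lemma row2_mul_delta (K : pzRingType) (x y c : K) :
  [/\ row2 x y *m (c *: (delta_mx 0 1 + delta_mx 1 0)) = row2 (y * c) (x * c),
      row2 x y *m (c *: delta_mx 0 0) = row2 (x * c) 0 &
      row2 x y *m (c *: delta_mx 1 1) = row2 0 (y * c)].
Proof.
by split; apply/rowP => e; rewrite !mxE !big_ord_recl big_ord0 !mxE /=;
  case: e => [[|[|//]] ?] /=;
  rewrite ?(add0r, addr0, mulr0, mulr1).
Qed.

Definition interleave (R : realType) (p q : nat -> R[i]) n :
    'rV[R[i]]_(\sum_(i < n) 2) :=
  \mxrow_(j < n) row2 (p j) (q j).

(** The action is on row vectors: the first entries p travel to the next block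
    and the second entries q to the previous one. *)
Lemma interleave_toeplitz (R : realType) (a b : R[i]) (p q : nat -> R[i]) n :
  q n = 0 ->
  interleave p q n *m toeplitz a b n =
  interleave (fun j => b * q j + a * (if j is i.+1 then p i else 0))
             (fun j => b * p j + a * q j.+1) n.
Proof.
move=> qn; rewrite /interleave /toeplitz mul_mxrow_mxblock.
apply: eq_mxrow => j.
transitivity (\sum_(i < n | i == j :> nat) row2 (b * q i) (b * p i)
  + \sum_(i < n | i.+1 == j :> nat) row2 (a * p i) 0
  + \sum_(i < n | i == j.+1 :> nat) row2 0 (a * q i)).
  rewrite [X in X + _ + _]big_mkcond [X in _ + X + _]big_mkcond.
  rewrite [X in _ + _ + X]big_mkcond -!big_split /=; apply: eq_bigr => i _.
  have [e0 e1 e2] := row2_mul_delta (p i) (q i) a.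
  have [e3 _ _] := row2_mul_delta (p i) (q i) b.
  rewrite [j == i.+1 :> nat]eq_sym [(j : nat) == i]eq_sym.
  have [ij|ij] := eqVneq (i : nat) j.
    rewrite e3 ij gtn_eqF ?ltnSn// ltn_eqF ?ltnSn// !addr0.
    by rewrite mulrC [_ * b]mulrC.
  have [ij'|ij'] := eqVneq i.+1 (j : nat).
    rewrite e1 -ij' ltn_eqF ?ltnS// add0r addr0 mulrC//.
  by rewrite !add0r; case: ifP => _; rewrite ?mulmx0// e2 mulrC.
rewrite (big_ord1_eq _ (fun i => row2 (b * q i) (b * p i))).
rewrite (big_ord1_eq _ (fun i => row2 0 (a * q i))) ltn_ord.
have -> : \sum_(i < n | i.+1 == j) row2 (a * p i) 0 =
    row2 (a * (if (j : nat) is i.+1 then p i else 0)) 0.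
  case: j => -[|j] /= jn.
    by rewrite big_pred0// mulr0; apply/rowP => e; rewrite !mxE if_same.
  by rewrite (big_ord1_eq _ (fun i => row2 (a * p i) 0)) (ltnW jn).
have -> : (if (j.+1 < n)%N then row2 0 (a * q j.+1) else 0) =
    row2 0 (a * q j.+1).
  case: ltnP => // nj.
  have -> : j.+1 = n by apply/eqP; rewrite eqn_leq nj ltn_ord.
  by rewrite qn mulr0; apply/rowP => e; rewrite !mxE if_same.
by apply/rowP => e; rewrite !mxE; case: ifP; rewrite ?(addr0, add0r).
Qed.

Lemma interleaveZ (R : realType) (l : R[i]) (p q : nat -> R[i]) n :
  l *: interleave p q n = interleave (fun j => l * p j) (fun j => l * q j) n.
Proof.
apply/rowP => e; rewrite !mxE.
by case: ifP.
Qed.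

Lemma interleave_inj (R : realType) (p q p' q' : nat -> R[i]) n j :
  interleave p q n = interleave p' q' n -> (j < n)%N ->
  p j = p' j /\ q j = q' j.
Proof.
rewrite /interleave => /eq_mxrowP E jn; have /rowP F := E (Ordinal jn).
by split; [have := F 0 | have := F 1]; rewrite !mxE.
Qed.

(** Continuing p and q by zero beyond the last block encodes the boundary
    condition at the right end. *)
Lemma interleave_exists (R : realType) n (v : 'rV[R[i]]_(\sum_(i < n) 2)) :
  exists p q : nat -> R[i],
    [/\ v = interleave p q n, forall j, (n <= j)%N -> p j = 0 &
        forall j, (n <= j)%N -> q j = 0].
Proof.
exists (fun j => oapp (fun i : 'I_n => submxrow v i 0 0) 0 (insub j)).
exists (fun j => oapp (fun i : 'I_n => submxrow v i 0 1) 0 (insub j)).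
split=> [|j nj|j nj]; [|by rewrite insubN// -leqNgt..].
rewrite -[LHS]submxrowK; apply: eq_mxrow => j; apply/rowP => e.
rewrite !mxE valK /=.
have [->|e0] := eqVneq e 0; first by rewrite mxE.
have -> : e = 1 by apply/val_inj; case: e e0 => -[|[|//]].
by rewrite mxE.
Qed.

Lemma sqr_normcE (R : rcfType) (z : R[i]) :
  normc z ^+ 2 = complex.Re z ^+ 2 + complex.Im z ^+ 2.
Proof. by case: z => x y /=; rewrite sqr_sqrtr// addr_ge0// sqr_ge0. Qed.

Lemma normc_ge0 (R : rcfType) (z : R[i]) : 0 <= normc z.
Proof. by case: z => x y; rewrite sqrtr_ge0. Qed.

Lemma normc_eq0 (R : rcfType) (z : R[i]) : (normc z == 0) = (z == 0).
Proof.
by apply/eqP/eqP => [/Normc.eq0_normc|->]//; rewrite Normc.normc0.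
Qed.

(** The matrix with rows (b, a) and (a, b) is diagonal in the orthogonal basis
    (1, 1), (1, -1), with eigenvalues a + b and b - a. *)
Lemma symmetric_pair_bound (R : rcfType) (a b x y : R[i]) (M : R) :
  normc (a + b) <= M -> normc (a - b) <= M ->
  normc (b * x + a * y) ^+ 2 + normc (b * y + a * x) ^+ 2 <=
    M ^+ 2 * (normc x ^+ 2 + normc y ^+ 2).
Proof.
move=> sM dM.
have parallelogram (u v : R[i]) : normc u ^+ 2 + normc v ^+ 2 =
    (normc (u + v) ^+ 2 + normc (u - v) ^+ 2) / 2.
  by rewrite !sqr_normcE; case: u v => [u1 u2] [v1 v2] /=; field.
have M0 : 0 <= M := le_trans (normc_ge0 _) sM.
rewrite parallelogram [X in _ <= _ * X]parallelogram mulrA.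
rewrite ler_wpM2r ?invr_ge0// mulrDr.
have -> : b * x + a * y + (b * y + a * x) = (a + b) * (x + y) by ring.
have -> : b * x + a * y - (b * y + a * x) = - (a - b) * (x - y) by ring.
rewrite !Normc.normcM normcN !exprMn.
by rewrite lerD// ler_wpM2r ?sqr_ge0// ler_sqr ?nnegrE ?normc_ge0.
Qed.

(** The pairs [(q_j, p_(j-1))] for [0 <= j <= n], with zeros outside the range,
    cover the vector exactly once, and so do the pairs [(p_j, q_(j-1))]; each
    of the latter depends on the former with the same index only, through the
    matrix of [symmetric_pair_bound]. *)
Lemma eigenvalue_toeplitz_le (R : realType) (a b : R[i]) n l :
  eigenvalue (toeplitz a b n) l ->
  normc l <= Num.max (normc (a + b)) (normc (a - b)).
Proof.
set M := Num.max _ _ => /eigenvalueP[v vT v0].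
have M0 : 0 <= M by rewrite le_max normc_ge0.
have [p [q [vE p0 q0]]] := interleave_exists v.
rewrite vE interleave_toeplitz ?q0// interleaveZ in vT.
have lp j : (j < n)%N ->
    l * p j = b * q j + a * (if j is i.+1 then p i else 0).
  by move=> jn; have [-> _] := interleave_inj vT jn.
have lq j : (j < n)%N -> l * q j = b * p j + a * q j.+1.
  by move=> jn; have [_ ->] := interleave_inj vT jn.
pose sh (f : nat -> R[i]) j : R[i] := if j is i.+1 then f i else 0.
pose S := \sum_(j < n) (normc (p j) ^+ 2 + normc (q j) ^+ 2).
have shiftS (f g : nat -> R[i]) : f n = 0 ->
    \sum_(j < n.+1) (normc (f j) ^+ 2 + normc (sh g j) ^+ 2) =
    \sum_(j < n) (normc (f j) ^+ 2 + normc (g j) ^+ 2).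
  move=> fn; rewrite !big_split/= big_ord_recr/= [X in _ + X]big_ord_recl/=.
  by rewrite fn Normc.normc0 expr0n/= !addr0 sqrtr0 expr0n/= add0r.
have lS : normc l ^+ 2 * S <= M ^+ 2 * S.
  rewrite {1}/S -(shiftS p q) ?p0// /S.
  under [X in _ <= _ * X]eq_bigr do rewrite addrC.
  rewrite -(shiftS q p) ?q0// !mulr_sumr; apply: ler_sum => -[j jn] _ /=.
  rewrite mulrDr -!exprMn -!Normc.normcM.
  (* These are equalities, except at the end pairs, where the output entry that
     falls outside the vector is zero. *)
  have np : normc (l * p j) <= normc (b * q j + a * sh p j).
    case: (ltnP j n) => [/lp->//|/p0->].
    by rewrite mulr0 Normc.normc0 normc_ge0.
  have nq : normc (l * sh q j) <= normc (b * sh p j + a * q j).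
    case: j jn {np} => [|j] jn/=; last by rewrite -lq.
    by rewrite mulr0 Normc.normc0 normc_ge0.
  have [sM dM] : normc (a + b) <= M /\ normc (a - b) <= M.
    by rewrite !le_max !lexx orbT.
  apply: le_trans (symmetric_pair_bound (q j) (sh p j) sM dM).
  by rewrite lerD// ler_sqr ?nnegrE ?normc_ge0.
have S0 : 0 < S.
  rewrite lt_neqAle sumr_ge0 ?andbT; last first.
    by move=> i _; rewrite addr_ge0 ?sqr_ge0.
  apply: contraNneq v0 => /esym/eqP; rewrite psumr_eq0 => [/allP S0|i _].
    rewrite vE; apply/eqP/mxrowP => j; rewrite mxrowK.
    have := S0 j (mem_index_enum _).
    rewrite paddr_eq0 ?sqr_ge0// !sqrf_eq0 !normc_eq0 => /andP[/eqP pj /eqP qj].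
    by apply/rowP => e; rewrite pj qj !mxE if_same.
  by rewrite addr_ge0 ?sqr_ge0.
by move: lS; rewrite ler_pM2r// ler_sqr ?nnegrE ?normc_ge0.
Qed.

(** * Eigenvalues close to a + b and a - b *)

(** Up to the factor [(a l) ^ n], the value at l is the n-th term of the
    sequence q that the eigenvalue equation forces on the second entries of the
    blocks, starting from [q_0 = 1]. In terms of the Chebyshev polynomials U of
    the second kind, normalised by [U_1 x = x] and evaluated at
    [x = (l ^ 2 + a ^ 2 - b ^ 2) / (a l)], it equals
    [(a l) ^ n * (U_n x - (a / l) * U_(n-1) x)]. *)
Fixpoint chi (K : fieldType) (a b : K) n : {poly K} :=
  match n with
  | 0 => 1
  | n'.+1 => match n' with
    | 0 => 'X^2 - (b ^+ 2)%:P
    | n''.+1 => ('X^2 + (a ^+ 2 - b ^+ 2)%:P) * chi a b n'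
                - (a ^+ 2)%:P * 'X^2 * chi a b n''
    end
  end.

Lemma chiSS (K : fieldType) (a b : K) n :
  chi a b n.+2 = ('X^2 + (a ^+ 2 - b ^+ 2)%:P) * chi a b n.+1
                - (a ^+ 2)%:P * 'X^2 * chi a b n.
Proof. by []. Qed.

Lemma two_step_ind (P : nat -> Prop) :
  P 0 -> P 1 -> (forall n, P n -> P n.+1 -> P n.+2) -> forall n, P n.
Proof.
move=> P0 P1 PS n; suff [] : P n /\ P n.+1 by [].
by elim: n => [|n [Pn PSn]]; split=> //; apply: PS.
Qed.

Lemma size_chi (K : fieldType) (a b : K) n : (size (chi a b n) <= n.*2.+1)%N.
Proof.
have size_X2D (c : K) : (size ('X^2 + c%:P)%R <= 3)%N.
  rewrite (leq_trans (size_polyD _ _))// geq_max size_polyXn/=.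
  exact: leq_trans (size_polyC_leq1 _) _.
have size_ZX2 (c : K) : (size (c%:P * 'X^2)%R <= 3)%N.
  by rewrite mul_polyC (leq_trans (size_scale_leq _ _))// size_polyXn.
elim/two_step_ind: n => [||n IH0 IH1]; first by rewrite /= size_poly1.
  by rewrite /= -polyCN size_X2D.
rewrite chiSS (leq_trans (size_polyD _ _))// geq_max size_polyN.
apply/andP; split; apply: leq_trans (size_polyMleq _ _) _.
  by rewrite -subn1 (leq_trans (leq_sub2r 1 (leq_add (size_X2D _) IH1))).
by rewrite -subn1 (leq_trans (leq_sub2r 1 (leq_add (size_ZX2 _) IH0)))//; lia.
Qed.

(** At [l = a + c] the characteristic equation
    [w^2 - (l^2 + a^2 - b^2) w + a^2 l^2 = 0] of the recursion has the double
    root [a l], so that the solutions are [(a l)^n] times polynomials in n. *)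
Lemma chi_double_point (K : fieldType) (a b c : K) n : c ^+ 2 = b ^+ 2 ->
  let l := a + c in
  l * (chi a b n).[l] = (a * l) ^+ n * (a + n.+1%:R * c) /\
  3 * a * l ^+ 2 * (chi a b n)^`().[l] =
    (a * l) ^+ n * (n%:R * (c ^+ 2 * n.+1%:R * n.+2%:R
                            + 6 * a * c * n.+1%:R + 6 * a ^+ 2)).
Proof.
move=> cb l; elim/two_step_ind: n => [||n [IH0 IH0'] [IH1 IH1']].
- by rewrite /= hornerC -polyC1 derivC hornerC !mulr0 !mul0r mulr0 !mul1r mulr1.
- rewrite /= !poly.derivE !hornerE/= -cb /l; split; ring.
rewrite chiSS -cb.
move: (chi a b n) (chi a b n.+1) IH0 IH0' IH1 IH1' => P Q IH0 IH0' IH1 IH1'.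
rewrite !poly.derivE !(hornerE, hornerXn) /=.
move: P.[l] Q.[l] P^`().[l] Q^`().[l] IH0 IH0' IH1 IH1'.
move=> x0 x1 y0 y1 IH0 IH0' IH1 IH1'; split.
  transitivity ((l ^+ 2 + (a ^+ 2 - c ^+ 2)) * (l * x1)
                - a ^+ 2 * l ^+ 2 * (l * x0)); first by ring.
  rewrite IH0 IH1 !(exprS (a * l)); move: ((a * l) ^+ n) => s.
  by rewrite /l; ring.
transitivity (6 * a * l ^+ 2 * (l * x1)
    + (l ^+ 2 + (a ^+ 2 - c ^+ 2)) * (3 * a * l ^+ 2 * y1)
    - a ^+ 2 * (6 * a * l ^+ 2 * (l * x0))
    - a ^+ 2 * l ^+ 2 * (3 * a * l ^+ 2 * y0)); first by rewrite /l; ring.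
rewrite IH0 IH1 IH0' IH1' !(exprS (a * l)); move: ((a * l) ^+ n) => s.
by rewrite /l; ring.
Qed.

(** The logarithmic derivative of p at x is the sum of the [1 / (x - r)] over
    the roots r. *)
Lemma nearest_root (R : rcfType) (p : {poly R[i]}) (x : R[i]) (d : R) :
  p != 0 -> (forall r, root p r -> d <= normc (x - r)) ->
  normc p^`().[x] * d <= (size p).-1%:R * normc p.[x].
Proof.
move=> p0; have [rs pE] := closed_field_poly_normal p.
have lc0 : lead_coef p != 0 by rewrite lead_coef_eq0.
move=> farp; have {farp} far : forall r, r \in rs -> d <= normc (x - r).
  by move=> r rrs; apply: farp; rewrite pE rootZ// root_prod_XsubC.
have -> : (size p).-1 = size rs by rewrite pE size_scale// size_prod_XsubC.
rewrite pE derivZ !hornerZ !Normc.normcM -mulrA.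
rewrite [leRHS]mulrCA ler_wpM2l ?normc_ge0//.
elim: rs {pE} far => [|r rs IH] far.
  by rewrite big_nil -polyC1 derivC hornerC Normc.normc0 !mul0r.
rewrite big_cons derivM derivXsubC mul1r !hornerE /= Normc.normcM.
set Q := \prod_(_ <- _) _ in IH *.
have IHQ : normc Q^`().[x] * d <= (size rs)%:R * normc Q.[x].
  by apply: IH => s srs; apply: far; rewrite inE srs orbT.
have dr : d <= normc (x - r) by apply: far; rewrite inE eqxx.
have [d0|d0] := leP d 0.
  rewrite (@le_trans _ _ 0) ?mulr_ge0 ?normc_ge0// mulr_ge0_le0 ?normc_ge0//.
apply: (@le_trans _ _ ((normc Q.[x] + normc ((x - r) * Q^`().[x])) * d)).
  by rewrite ler_wpM2r ?(ltW d0)// le_normcD.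
rewrite mulrDl Normc.normcM -mulrA -natr1 mulrDl [leRHS]addrC mul1r.
rewrite lerD//; first by rewrite mulrC ler_wpM2r ?normc_ge0.
by rewrite [leRHS]mulrCA ler_wpM2l ?normc_ge0.
Qed.

Lemma normc_nat (R : rcfType) n : normc (n%:R : R[i]) = n%:R.
Proof. by rewrite normcMn Normc.normc1. Qed.

(** By [chi_double_point] the derivative exceeds the value by a factor of order
    n^2 while there are at most 2n roots. *)
Lemma chi_root_near (R : realType) (a b c : R[i]) (e : R) :
  a != 0 -> b != 0 -> c ^+ 2 = b ^+ 2 -> a + c != 0 -> 0 < e ->
  exists n0, forall n, (n0 <= n)%N ->
    exists2 l, root (chi a b n) l & normc (a + c - l) < e.
Proof.
move=> a0 b0 cb l0 e0; set l := a + c in l0 *.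
have c0 : c != 0 by rewrite -sqrf_eq0 cb sqrf_eq0.
have pos (z : R[i]) : z != 0 -> 0 < normc z.
  by move=> z0; rewrite lt_neqAle eq_sym normc_eq0 z0 normc_ge0.
pose s := a * l.
have s0 : 0 < normc s by rewrite pos// mulf_neq0.
pose X := (12 * normc a * e + 12 * normc s) / (normc c * e).
exists (Num.truncn X).+1 => n n0n; apply: contrapT => noroot.
have far r : root (chi a b n) r -> e <= normc (l - r).
  by move=> rr; rewrite leNgt; apply/negP => re; apply: noroot; exists r.
have n0 : (0 < n)%N by case: n n0n {noroot far}.
have chi0 : chi a b n != 0.
  apply/eqP => E; have := far l; rewrite E root0 subrr => /(_ isT).
  by rewrite Normc.normc0 leNgt e0.
have := nearest_root chi0 far.
have [E0 E1] := chi_double_point a n cb; rewrite -/l -/s in E0 E1.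
have {chi0}sz : (size (chi a b n)).-1%:R <= 2 * n%:R :> R.
  rewrite -natrM ler_nat mul2n -ltnS prednK ?size_chi//.
  by rewrite lt0n size_poly_eq0.
move=> /le_trans /(_ (ler_wpM2r (normc_ge0 _) sz)).
have w0 : 0 < normc (3 * a * l ^+ 2).
  by rewrite pos// !mulf_neq0 ?expf_neq0// pnatr_eq0.
rewrite -(ler_pM2l w0) [leLHS]mulrA -Normc.normcM E1.
have -> : normc (3 * a * l ^+ 2) * (2 * n%:R * normc (chi a b n).[l]) =
    6 * n%:R * (normc s * normc (s ^+ n * (a + n.+1%:R * c))).
  by rewrite -E0 /s !Normc.normcM normc_nat; ring.
set y : R[i] := n.+1%:R.
set Q := c ^+ 2 * y * n.+2%:R + 6 * a * c * y + 6 * a ^+ 2.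
have sn0 : 0 < normc (s ^+ n) by rewrite pos// expf_neq0// mulf_neq0.
have nn0 : 0 < n%:R :> R by rewrite ltr0n.
rewrite [normc (_ * (_ * Q))]Normc.normcM [normc (_ * Q)]Normc.normcM normc_nat.
rewrite [normc (s ^+ n * _)]Normc.normcM.
set A := normc a; set C := normc c; set S := normc s in s0 *.
pose T := n.+1%:R * C.
have C0 : 0 < C by exact: pos.
have A0 : 0 <= A by exact: normc_ge0.
have T_large : 12 * A * e + 12 * S < T * e.
  have : X < n.+1%:R.
    by rewrite (lt_le_trans (truncnS_gt _))// ler_nat leqW.
  by rewrite ltr_pdivrMr ?mulr_gt0// mulrA.
have T0 : 0 < T by rewrite mulr_gt0.
have AT : A <= T.
  by rewrite -(ler_pM2r e0); nra.
(* Q is the bracket of the derivative formula; its leading term c^2 n^2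
   dominates. *)
have Qge : T ^+ 2 - 6 * A * T - 6 * A ^+ 2 <= normc Q.
  have EQ : c ^+ 2 * y * n.+2%:R = Q + (- (6 * a * c * y + 6 * a ^+ 2)).
    by rewrite /Q; ring.
  have := le_normcD Q (- (6 * a * c * y + 6 * a ^+ 2)).
  rewrite -EQ normcN => H1.
  have := le_normcD (6 * a * c * y) (6 * a ^+ 2).
  rewrite !Normc.normcM !normc_nat -/A -/C in H1 * => H2.
  have n12 : n.+1%:R <= n.+2%:R :> R by rewrite ler_nat.
  have : T ^+ 2 <= C * C * n.+1%:R * n.+2%:R.
    have -> : T ^+ 2 = C * C * n.+1%:R * n.+1%:R by rewrite /T; ring.
    by rewrite ler_wpM2l// !mulr_ge0// ltW.
  by rewrite /T; lra.
have Rle : normc (a + y * c) <= A + T.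
  by rewrite (le_trans (le_normcD _ _))// Normc.normcM normc_nat.
move=> main.
have {main} : normc Q * e <= 6 * S * (A + T).
  rewrite -(ler_pM2l (mulr_gt0 sn0 nn0)).
  have -> : normc (s ^+ n) * n%:R * (normc Q * e) =
    normc (s ^+ n) * (n%:R * normc Q) * e by ring.
  apply: le_trans main _.
  have -> : 6 * n%:R * (S * (normc (s ^+ n) * normc (a + y * c))) =
    normc (s ^+ n) * n%:R * (6 * S * normc (a + y * c)) by ring.
  by rewrite !ler_wpM2l// ?mulr_ge0 ?(ltW sn0) ?(ltW s0).
rewrite leNgt => /negP; apply.
apply: lt_le_trans (_ : (T ^+ 2 - 6 * A * T - 6 * A ^+ 2) * e <= _); last first.
  by rewrite ler_wpM2r// ltW.
have p2 : 0 <= A * (T - A) * e by rewrite !mulr_ge0 ?subr_ge0// ltW.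
have p3 : 0 <= S * (T - A) by rewrite mulr_ge0 ?subr_ge0// ltW.
have p4 : 0 < T * (T * e - (12 * A * e + 12 * S)).
  by rewrite mulr_gt0// subr_gt0.
nra.
Qed.

(** The equation for the second entries defines p from q, the recursion of [chi]
    is the equation for the first entries, and [q_n = 0] is the boundary
    condition at the right end. *)
Lemma root_chi_eigenvalue (R : realType) (a b l : R[i]) n :
  a != 0 -> b != 0 -> l != 0 -> root (chi a b n) l ->
  eigenvalue (toeplitz a b n) l.
Proof.
move=> a0 b0 l0 /eqP rl.
have n0 : (0 < n)%N.
  by case: n rl => // /eqP; rewrite /= hornerC oner_eq0.
pose q j := (chi a b j).[l] / (a * l) ^+ j.
pose p j := (l * q j - a * q j.+1) / b.
have qn : q n = 0 by rewrite /q rl mul0r.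
apply/eigenvalueP; exists (interleave p q n); last first.
  apply: contra_neq (oner_neq0 R[i]) => E.
  have [_] : p 0%N = 0 /\ q 0%N = 0.
    apply: (@interleave_inj _ p q (fun=> 0) (fun=> 0) n) => //; rewrite E.
    by apply/esym/mxrowP => j; rewrite mxrowK;
      apply/rowP => e; rewrite !mxE if_same.
  by rewrite /q /= hornerC divr1.
rewrite interleave_toeplitz// interleaveZ; apply: eq_mxrow => j.
congr row2; last by rewrite /p; field.
case: (nat_of_ord j) => [|i]; rewrite /p /q.
  by rewrite /= !hornerE /=; field; rewrite a0 b0 l0.
rewrite chiSS; move: (chi a b i) (chi a b i.+1) => P Q.
rewrite !(hornerE, hornerXn) /= !(exprS (a * l)).
by field; rewrite a0 b0 l0 expf_neq0// mulf_neq0.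
Qed.

(** The empty spectrum, of radius 0, is the reason for the sign condition. *)
Lemma spectral_radius_le (R : realType) n (A : 'M[R[i]]_n) (M : R) :
  0 <= M -> (forall l, eigenvalue A l -> normc l <= M) ->
  spectral_radius A <= M.
Proof.
move=> M0 AM; rewrite /spectral_radius.
set E := [set _ | _ in _].
have [/eqP->|E0] := pselect (E == set0); first by rewrite sup0.
by apply: ge_sup; [apply/set0P/negP|move=> _ [l Al <-]; exact: AM].
Qed.

Lemma normc_le_spectral_radius (R : realType) n (A : 'M[R[i]]_n) (M : R) l :
  (forall l, eigenvalue A l -> normc l <= M) ->
  eigenvalue A l -> normc l <= spectral_radius A.
Proof.
move=> AM Al; apply: ub_le_sup; last by exists l.
by exists M => _ [m Am <-]; exact: AM.
Qed.

Lemma cvg_spectral_radius_toeplitz (R : realType) (a b : R[i]) :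
  a != 0 -> b != 0 ->
  (fun N => spectral_radius (toeplitz a b N.-1)) @ \oo -->
    Num.max (normc (a + b)) (normc (a - b)).
Proof.
move=> a0 b0; set M := Num.max _ _.
(* c is the sign of b that realises the maximum. *)
have [c cb cM] : exists2 c, c ^+ 2 = b ^+ 2 & normc (a + c) = M.
  rewrite /M; case: leP => _; last by exists b.
  by exists (- b) => //; rewrite sqrrN.
have M0 : 0 < M.
  rewrite lt_max !lt_neqAle !normc_ge0 !andbT ![0 == _]eq_sym !normc_eq0.
  rewrite -negb_and; apply: contra a0 => /andP[/eqP e1 /eqP e2].
  have /eqP : a * 2%:R = 0 by rewrite -[RHS]addr0 -{1}e1 -e2; ring.
  by rewrite mulf_eq0 pnatr_eq0 orbF.
have ac0 : a + c != 0 by rewrite -normc_eq0 cM gt_eqF.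
apply/cvgrPdist_le => e e0.
(* The distance is also kept below M to keep the root away from 0. *)
have eM0 : 0 < Num.min e M by rewrite lt_min e0.
have [n0 near_root] := chi_root_near a0 b0 cb ac0 eM0.
exists n0.+1 => // N /= n0N.
have UB := @eigenvalue_toeplitz_le _ a b N.-1.
have le_M : spectral_radius (toeplitz a b N.-1) <= M.
  by apply: spectral_radius_le => //; exact: ltW.
rewrite ger0_norm ?subr_ge0// lerBlDr.
have [|l rl] := near_root N.-1; first by case: (N) n0N.
rewrite lt_min => /andP[le lM].
have l0 : l != 0 by apply: contraTneq lM => ->; rewrite subr0 cM ltxx.
have := normc_le_spectral_radius UB (root_chi_eigenvalue a0 b0 l0 rl).
rewrite addrC => lr; rewrite -cM.
have -> : a + c = l + (a + c - l) by ring.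
by rewrite (le_trans (le_normcD _ _))// lerD// ltW.
Qed.

(** * Complex exponentials and exponential sums *)

Lemma expR_subN_ge (R : realType) (x : R) : 0 <= x ->
  2 * x <= expR x - expR (- x).
Proof.
move=> x0; pose f (y : R) := expR y - expR (- y).
have df (y : R) : is_derive y 1 f (expR y + expR (- y)).
  by apply: is_derive_eq; rewrite mulrN1 opprK.
have [|c _] := @MVT_segment R f _ _ _ x0 (fun y _ => df y).
  apply: continuous_subspaceT => y.
  exact/differentiable_continuous/derivable1_diffP.
rewrite /f oppr0 subrr oppr0 !addr0 => ->; rewrite ler_wpM2r//.
have := expRxMexpNx_1 c; have := expR_gt0 c; have := expR_gt0 (- c).
set p := expR c; set q := expR _ => q0 p0 pq.
have := sqr_ge0 (p - q); nra.
Qed.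

Lemma normr_sin_le (R : realType) (x : R) : 0 <= x -> `|sin x| <= x.
Proof.
move=> x0.
have [|c _] := @MVT_segment R sin cos _ _ x0 (fun y _ => is_derive_sin y).
  by apply: continuous_subspaceT => y; exact: continuous_sin.
rewrite sin0 !subr0 => ->; rewrite normrM (ger0_norm x0).
by rewrite ler_piMl// cos_max.
Qed.

Lemma cexpD (R : realType) (z w : R[i]) : cexp (z + w) = cexp z * cexp w.
Proof.
case: z w => [z1 z2] [w1 w2]; rewrite /cexp /= expRD cosD sinD.
by simpc; congr (_ +i* _); ring.
Qed.

Lemma normc_cexp (R : realType) (z : R[i]) :
  normc (cexp z) = expR (complex.Re z).
Proof.
rewrite /cexp Normc.normcM /= expr0n addr0 sqrtr_sqr cos2Dsin2 sqrtr1 mulr1.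
by rewrite ger0_norm ?expR_ge0.
Qed.

Lemma cexpMN (R : realType) (z : R[i]) : cexp z * cexp (- z) = 1.
Proof.
by rewrite -cexpD subrr /cexp /= expR0 cos0 sin0; simpc.
Qed.

(** With [u = z + alpha] and [v = z - alpha], the coefficients (u, - v) and
    (u, v) come from applying the impedance operator d/dt + alpha to the even,
    resp. odd, solution of [w'' = z^2 w]: the two symmetry classes of a
    subdomain centred at 0. *)
Definition wave (R : realType) (u v z : R[i]) (t : R) : R[i] :=
  u * cexp (z * t%:C) + v * cexp (- (z * t%:C)).

Lemma Re_mul_real (R : realType) (z : R[i]) (t : R) :
  complex.Re (z * t%:C) = complex.Re z * t.
Proof. by case: z => x y /=; rewrite mulr0 subr0. Qed.

Lemma wave_lower (R : realType) (u v z : R[i]) (t : R) :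
  normc v <= normc u ->
  normc u * (expR (complex.Re z * t) - expR (- (complex.Re z * t))) <=
  normc (wave u v z t).
Proof.
move=> vu; rewrite /wave.
set U := u * _; set V := v * _.
have nU : normc U = normc u * expR (complex.Re z * t).
  by rewrite Normc.normcM normc_cexp Re_mul_real.
have nV : normc V = normc v * expR (- (complex.Re z * t)).
  by rewrite Normc.normcM normc_cexp raddfN /= Re_mul_real.
have := le_normcD (U + V) (- V); rewrite addrK normcN nU nV => H.
have : normc v * expR (- (complex.Re z * t)) <=
       normc u * expR (- (complex.Re z * t)) by rewrite ler_wpM2r ?expR_ge0.
by rewrite mulrBr; lra.
Qed.

Lemma wave_upper (R : realType) (u v z : R[i]) (t : R) :
  normc v <= normc u ->
  normc (wave u v z t) <=
  normc u * (expR (complex.Re z * t) + expR (- (complex.Re z * t))).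
Proof.
move=> vu; rewrite /wave (le_trans (le_normcD _ _))//.
rewrite (Normc.normcM u) (Normc.normcM v) !normc_cexp.
by rewrite raddfN /= Re_mul_real mulrDr lerD2l ler_wpM2r ?expR_ge0.
Qed.

(** The growing exponential strictly dominates. *)
Lemma wave_neq0 (R : realType) (u v z : R[i]) (t : R) :
  u != 0 -> normc v <= normc u -> 0 < complex.Re z -> 0 < t ->
  wave u v z t != 0.
Proof.
move=> u0 vu z0 t0; rewrite -normc_eq0 gt_eqF//.
apply: lt_le_trans (wave_lower _ _ vu).
rewrite mulr_gt0//; first by rewrite lt_neqAle eq_sym normc_eq0 u0 normc_ge0.
by rewrite subr_gt0 ltr_expR; have := mulr_gt0 z0 t0; lra.
Qed.

Lemma sqr_normc_wave (R : realType) (u v z : R[i]) (t : R) :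
  let: (u1, u2) := (complex.Re u, complex.Im u) in
  let: (v1, v2) := (complex.Re v, complex.Im v) in
  let: (x, y) := (complex.Re z, complex.Im z) in
  normc (wave u v z t) ^+ 2 =
    normc u ^+ 2 * expR (2 * x * t) + normc v ^+ 2 * expR (- (2 * x * t))
    + 2 * ((u1 * v1 + u2 * v2) * cos (2 * y * t)
           - (u2 * v1 - u1 * v2) * sin (2 * y * t)).
Proof.
rewrite !sqr_normcE; case: u v z => [u1 u2] [v1 v2] [x y] /=.
have -> : 2 * x * t = x * t + x * t by ring.
have -> : 2 * y * t = y * t + y * t by ring.
rewrite !(mulr0, mul0r, subr0, addr0, add0r) opprD !expRD cosD sinD.
rewrite cosN sinN.
have := expRxMexpNx_1 (x * t); have := cos2Dsin2 (y * t).
set E := expR (x * t); set E' := expR (- _).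
set c := cos _; set s := sin _ => cs EE.
transitivity ((u1 ^+ 2 + u2 ^+ 2) * (E * E) * (c ^+ 2 + s ^+ 2)
   + (v1 ^+ 2 + v2 ^+ 2) * (E' * E') * (c ^+ 2 + s ^+ 2)
   + 2 * (E * E') * ((u1 * v1 + u2 * v2) * (c * c - s * s)
                     - (u2 * v1 - u1 * v2) * (s * c + c * s))).
  ring.
by rewrite cs EE !mulr1 -!expr2.
Qed.

(** * Comparison of hyperbolic and trigonometric terms *)

(** Only the products of [x L] and [2 x d], resp. [y L] and [2 y d], survive in
    the difference, by the product-to-sum formulas. *)
Lemma wave_gap (R : realType) (u1 u2 v1 v2 x y d L : R) :
  normc (wave (u1 +i* u2) (v1 +i* v2) (x +i* y) (d + L / 2)) ^+ 2
  - normc (wave (u1 +i* u2) (v1 +i* v2) (x +i* y) (d - L / 2)) ^+ 2 =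
  (expR (x * L) - expR (- (x * L))) *
    ((u1 ^+ 2 + u2 ^+ 2) * expR (2 * x * d)
     - (v1 ^+ 2 + v2 ^+ 2) * expR (- (2 * x * d)))
  - 4 * sin (y * L) * ((u1 * v1 + u2 * v2) * sin (2 * y * d)
                       + (u2 * v1 - u1 * v2) * cos (2 * y * d)).
Proof.
have half' (w : R) : 2 * w * (d + L / 2) = 2 * w * d + w * L by field.
have halfN (w : R) : 2 * w * (d - L / 2) = 2 * w * d - w * L by field.
rewrite !sqr_normc_wave !sqr_normcE /= !half' !halfN !opprD opprK !expRD.
by rewrite !cosD !sinD !cosN !sinN; ring.
Qed.

(** Either condition controls the bulk part of [damped_gap]. The first one holds
    for evanescent modes, and for all modes when [k <= s]. *)
Definition damped (R : realType) (k s d L kt x : R) : Prop :=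
  k ^+ 2 - kt ^+ 2 <= s ^+ 2 \/ 1 <= 2 * x ^+ 2 * L * d.

(** Writing Z for [x^2 + y^2] and A for [s^2 + k^2], the right-hand side splits
    into a bulk part with factor Z + A and a boundary part with factor
    [p = x s + y k]; they dominate the parts of the left-hand side with
    factors Z - A and [q = k x - s y] respectively. *)
Lemma damped_gap (R : realType) (k s d L kt x y : R) :
  0 < k -> 0 < s -> 0 < d -> 0 < L -> 0 < kt -> 0 < x -> 0 < y ->
  2 * x * y = k * s -> x ^+ 2 - y ^+ 2 = kt ^+ 2 - k ^+ 2 ->
  damped k s d L kt x ->
  `|4 * sin (y * L) *
      (((x + s) * (x - s) + (y + k) * (y - k)) * sin (2 * y * d)
       + ((y + k) * (x - s) - (x + s) * (y - k)) * cos (2 * y * d))| <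
  (expR (x * L) - expR (- (x * L))) *
    (((x + s) ^+ 2 + (y + k) ^+ 2) * expR (2 * x * d)
     - ((x - s) ^+ 2 + (y - k) ^+ 2) * expR (- (2 * x * d))).
Proof.
move=> k0 s0 d0 L0 kt0 x0 y0 xy x2y2 damp.
have yL0 : 0 <= y * L by rewrite mulr_ge0 ?ltW.
have xd0 : 0 <= 2 * x * d by rewrite !mulr_ge0 ?ltW.
have yd0 : 0 <= 2 * y * d by rewrite !mulr_ge0 ?ltW.
have xL0 : 0 <= x * L by rewrite mulr_ge0 ?ltW.
have sh1_ge := expR_subN_ge xL0.
have sh2_ge := expR_subN_ge xd0.
have s1_le := normr_sin_le yL0.
have s2_le := normr_sin_le yd0.
have s1_le1 := sin_max (y * L).
have s2_le1 := sin_max (2 * y * d).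
have c2_le1 := cos_max (2 * y * d).
have ch2 : 2 <= expR (2 * x * d) + expR (- (2 * x * d)).
  have := expRxMexpNx_1 (2 * x * d); have := expR_gt0 (2 * x * d).
  have := expR_gt0 (- (2 * x * d)); move: (expR _) (expR _) => p q p0 q0 pq.
  have := sqr_ge0 (p - q); nra.
set Z := x ^+ 2 + y ^+ 2; set A := s ^+ 2 + k ^+ 2.
set p := x * s + y * k; set q := k * x - s * y.
have -> : (x + s) * (x - s) + (y + k) * (y - k) = Z - A.
  by rewrite /Z /A; ring.
have -> : (y + k) * (x - s) - (x + s) * (y - k) = 2 * q by rewrite /q; ring.
have -> : ((x + s) ^+ 2 + (y + k) ^+ 2) * expR (2 * x * d)
     - ((x - s) ^+ 2 + (y - k) ^+ 2) * expR (- (2 * x * d)) =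
  (Z + A) * (expR (2 * x * d) - expR (- (2 * x * d)))
  + 2 * p * (expR (2 * x * d) + expR (- (2 * x * d))).
  by rewrite /Z /A /p; ring.
have Z0 : 0 < Z by rewrite addr_gt0 ?exprn_gt0.
have A0 : 0 < A by rewrite addr_gt0 ?exprn_gt0.
have p0 : 0 < p by rewrite addr_gt0 ?mulr_gt0.
have xL0' : 0 < x * L by rewrite mulr_gt0.
have xd0' : 0 < 2 * x * d by rewrite !mulr_gt0.
move: (expR (x * L) - _) sh1_ge => S1 sh1_ge.
move: (expR (2 * x * d) - _) sh2_ge => S2 sh2_ge.
move: (expR (2 * x * d) + _) ch2 => C2 ch2.
have S1p : 0 < S1 by lra.
have S2p : 0 < S2 by lra.
set s1 := sin _ in s1_le s1_le1 *; set s2 := sin _ in s2_le s2_le1 *.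
set c2 := cos _ in c2_le1 *.
have s1S1 : 2 * x * `|s1| <= y * S1.
  apply: (@le_trans _ _ (2 * x * (y * L))).
    by rewrite ler_wpM2l// mulr_ge0// ltW.
  have -> : 2 * x * (y * L) = y * (2 * (x * L)) by ring.
  by rewrite ler_wpM2l// ltW.
have s2S2 : 2 * x * `|s2| <= y * S2.
  apply: (@le_trans _ _ (2 * x * (2 * y * d))).
    by rewrite ler_wpM2l// mulr_ge0// ltW.
  have -> : 2 * x * (2 * y * d) = y * (2 * (2 * x * d)) by ring.
  by rewrite ler_wpM2l// ltW.
(* Here S1 is at least (2 x / y) |sin (y L)|, and x p exceeds y |q| because
   kt is nonzero. *)
have boundary : `|4 * s1 * (2 * q * c2)| < S1 * (2 * p * C2).
  have qp : y * `|q| < x * p.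
    have -> : y * `|q| = `|y * q| by rewrite normrM (ger0_norm (ltW y0)).
    rewrite ltr_norml; apply/andP; split; rewrite -subr_gt0.
      have -> : y * q - - (x * p) = s * (x ^+ 2 - y ^+ 2) + k * (2 * x * y).
        by rewrite /p /q; ring.
      rewrite x2y2 xy.
      have -> : s * (kt ^+ 2 - k ^+ 2) + k * (k * s) = s * kt ^+ 2 by ring.
      by rewrite mulr_gt0 ?exprn_gt0.
    have -> : x * p - y * q = s * Z by rewrite /p /q /Z; ring.
    by rewrite mulr_gt0.
  rewrite !normrM (ger0_norm (_ : 0 <= 4 :> R))//.
  rewrite (ger0_norm (_ : 0 <= 2 :> R))//.
  apply: (@le_lt_trans _ _ (8 * (`|s1| * `|q|))).
    have : `|s1| * `|q| * `|c2| <= `|s1| * `|q| * 1.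
      by rewrite ler_wpM2l// mulr_ge0.
    by rewrite mulr1; lra.
  apply: (@lt_le_trans _ _ (4 * (S1 * p))); last first.
    have : 0 <= S1 * p * (C2 - 2) by rewrite !mulr_ge0 ?subr_ge0// ltW.
    by lra.
  have xy0 : 0 < x * y by rewrite mulr_gt0.
  rewrite -(ltr_pM2l xy0).
  have h1 : 0 <= (y * S1 - 2 * x * `|s1|) * (y * `|q|).
    by rewrite mulr_ge0 ?subr_ge0// mulr_ge0// ltW.
  have h2 : 0 < y * S1 * (x * p - y * `|q|).
    by rewrite !mulr_gt0 ?subr_gt0.
  by lra.
(* In the weak case S1 S2 contributes the factor (2 x / y)^2; in the strong
   case S1 S2 >= 4 and the sines are bounded by 1. *)
have bulk : `|4 * s1 * ((Z - A) * s2)| <= S1 * ((Z + A) * S2).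
  have ZA : `|Z - A| <= Z + A by rewrite ler_norml; apply/andP; split; lra.
  rewrite !normrM (ger0_norm (_ : 0 <= 4 :> R))//.
  case: damp => [weak|strong]; last first.
    apply: (@le_trans _ _ (4 * (Z + A))).
      have : `|s1| * (`|Z - A| * `|s2|) <= 1 * ((Z + A) * 1).
        by rewrite ler_pM// ?mulr_ge0// ler_pM.
      by lra.
    have : 4 <= S1 * S2.
      apply: (@le_trans _ _ (2 * (x * L) * (2 * (2 * x * d)))); first by lra.
      by rewrite ler_pM// mulr_ge0.
    have ZA0 : 0 < Z + A by rewrite addr_gt0.
    rewrite -(ler_pM2l ZA0) => h; apply: le_trans (le_trans h _).
      by rewrite mulrC.
    by rewrite le_eqVlt; apply/orP; left; apply/eqP; ring.
  have weigh : y ^+ 2 * `|Z - A| <= x ^+ 2 * (Z + A).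
    (* |zeta^2|^2 = |zeta|^4 *)
    have Z2 : Z ^+ 2 = (kt ^+ 2 - k ^+ 2) ^+ 2 + (k * s) ^+ 2.
      by rewrite -x2y2 -xy /Z; ring.
    have kt2 : 0 < kt ^+ 2 by rewrite exprn_gt0.
    have [ZA'|ZA'] := leP 0 (Z - A).
      rewrite ger0_norm// -subr_ge0.
      have -> : x ^+ 2 * (Z + A) - y ^+ 2 * (Z - A) =
          Z * (x ^+ 2 - y ^+ 2 + A) by rewrite /Z /A; ring.
      rewrite x2y2 mulr_ge0 ?(ltW Z0)// /A.
      by have := sqr_ge0 s; lra.
    rewrite ltr0_norm// -subr_ge0.
    have -> : x ^+ 2 * (Z + A) - y ^+ 2 * - (Z - A) =
        Z ^+ 2 + (x ^+ 2 - y ^+ 2) * A by rewrite /Z /A; ring.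
    rewrite Z2 x2y2 /A.
    have -> : (kt ^+ 2 - k ^+ 2) ^+ 2 + (k * s) ^+ 2 +
      (kt ^+ 2 - k ^+ 2) * (s ^+ 2 + k ^+ 2) =
      kt ^+ 2 * (s ^+ 2 - (k ^+ 2 - kt ^+ 2)) by ring.
    by rewrite mulr_ge0 ?subr_ge0// ltW.
  have y20 : 0 < y ^+ 2 by rewrite exprn_gt0.
  rewrite -(ler_pM2l y20).
  have h1 : 2 * x * `|s1| * (2 * x * `|s2|) <= y * S1 * (y * S2).
    by rewrite ler_pM// !mulr_ge0// ltW.
  have h2 : 0 <= 4 * (`|s1| * `|s2|) * (x ^+ 2 * (Z + A) - y ^+ 2 * `|Z - A|).
    by rewrite mulr_ge0 ?subr_ge0// !mulr_ge0.
  have h3 :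
      0 <= (y * S1 * (y * S2) - 2 * x * `|s1| * (2 * x * `|s2|)) * (Z + A).
    by rewrite mulr_ge0 ?subr_ge0// ltW// addr_gt0.
  by lra.
rewrite mulrDr [ltRHS]mulrDr.
by rewrite (le_lt_trans (ler_normD _ _))// ler_ltD.
Qed.

(** * The convergence factor of a mode *)

(** Since zeta^2 has positive imaginary part [k s], the principal root lies in
    the open first quadrant. *)
Lemma zetaP (R : realType) (k s kt : R) : 0 < k -> 0 < s ->
  exists x y : R, [/\ zeta k s kt = x +i* y, 0 < x, 0 < y,
    2 * x * y = k * s & x ^+ 2 - y ^+ 2 = kt ^+ 2 - k ^+ 2].
Proof.
move=> k0 s0.
have : 0 <= complex.Re (zeta k s kt).
  by rewrite /zeta /sqrtc /= sqrtr_ge0.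
have := sqr_sqrtc ((kt ^+ 2 - k ^+ 2) +i* (k * s)).
rewrite -/(zeta k s kt); case: (zeta k s kt) => x y /=.
rewrite expr2; simpc => -[re im] x0; exists x, y.
have xy : 2 * x * y = k * s by rewrite -im; ring.
have ks0 := mulr_gt0 k0 s0.
have x1 : 0 < x.
  by rewrite lt_neqAle x0 andbT; apply: contraTneq ks0 => E;
    rewrite -xy -E mulr0 mul0r ltxx.
split=> //.
by rewrite -(pmulr_rgt0 _ x1); lra.
Qed.

Lemma impedance_sum_diff (R : realType) (k s kt : R) :
  0 < k -> 0 < s ->
  let z := zeta k s kt in let al := alpha k s in
  [/\ 0 < complex.Re z, z + al != 0, z - al != 0 &
      normc (z - al) <= normc (z + al)].
Proof.
move=> k0 s0; have [x [y [-> x0 y0 xy x2y2]]] := zetaP kt k0 s0.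
have nz (a b : R) : 0 < a ^+ 2 + b ^+ 2 -> a +i* b != 0.
  by move=> ab; rewrite -normc_eq0 -sqrf_eq0 sqr_normcE gt_eqF.
split=> //.
- by simpc; rewrite nz// addr_gt0 ?exprn_gt0 ?addr_gt0.
- (* zeta = alpha would force 2 s k = k s. *)
  apply/eqP; rewrite /alpha; simpc => -[xs yk].
  have ks := mulr_gt0 k0 s0; move: xy.
  have -> : x = s by lra.
  have -> : y = k by lra.
  by rewrite [k * s]mulrC; lra.
rewrite -ler_sqr ?nnegrE ?normc_ge0// !sqr_normcE /= -subr_ge0.
have -> : (x + s) ^+ 2 + (y + k) ^+ 2 - ((x - s) ^+ 2 + (y - k) ^+ 2) =
  4 * (x * s + y * k) by ring.
by rewrite mulr_ge0// addr_ge0// mulr_ge0// ltW.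
Qed.

Section ModeCoefficients.
Variables (R : realType) (k s d L kt : R).
Hypotheses (k0 : 0 < k) (s0 : 0 < s) (d0 : 0 < d) (L0 : 0 < L).

Let z := zeta k s kt.
Let u := z + alpha k s.
Let v := z - alpha k s.
Let T := d + L / 2.
Let t := d - L / 2.

Let z0 : 0 < complex.Re z.
Proof. by have [] := impedance_sum_diff kt k0 s0. Qed.
Let u0 : u != 0. Proof. by have [] := impedance_sum_diff kt k0 s0. Qed.
Let v0 : v != 0. Proof. by have [] := impedance_sum_diff kt k0 s0. Qed.
Let vu : normc v <= normc u.
Proof. by have [] := impedance_sum_diff kt k0 s0. Qed.
Let T0 : 0 < T. Proof. by rewrite addr_gt0// divr_gt0. Qed.

Lemma wave_den_neq0 : wave u v z T != 0 /\ wave u (- v) z T != 0.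
Proof. by rewrite !wave_neq0// normcN. Qed.

(** With X and Y the exponentials at t and T, products of the form
    (u X - v / X) (u Y + v / Y) expand to the numerators of a + b and a - b,
    because X Y = exp (2 z d) and Y / X = exp (z L). *)
Lemma coef_factorizations :
  [/\ coef_den k s d L kt = wave u v z T * wave u (- v) z T,
      wave (u ^+ 2) (- v ^+ 2) z (2 * d) - u * v * wave 1 (- 1) z L =
        wave u v z T * wave u (- v) z t &
      wave (u ^+ 2) (- v ^+ 2) z (2 * d) + u * v * wave 1 (- 1) z L =
        wave u v z t * wave u (- v) z T].
Proof.
pose P := cexp (z * d%:C); pose P' := cexp (- (z * d%:C)).
pose Q := cexp (z * (L / 2)%:C); pose Q' := cexp (- (z * (L / 2)%:C)).
have PP : P * P' = 1 by exact: cexpMN.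
have QQ : Q * Q' = 1 by exact: cexpMN.
have Tp : z * T%:C = z * d%:C + z * (L / 2)%:C.
  by rewrite -mulrDr -rmorphD.
have tp : z * t%:C = z * d%:C - z * (L / 2)%:C.
  by rewrite -mulrBr -rmorphB.
have dp : z * (2 * d)%:C = z * d%:C + z * d%:C.
  by rewrite -mulrDr -rmorphD /=; congr (_ * _%:C); ring.
have Lp : z * L%:C = z * (L / 2)%:C + z * (L / 2)%:C.
  by rewrite -mulrDr -rmorphD /=; congr (_ * _%:C); field.
have TT : z * (2 * d + L)%:C = z * T%:C + z * T%:C.
  by rewrite -mulrDr -rmorphD /=; congr (_ * _%:C); rewrite /T; field.
rewrite /coef_den /wave -/z -/u -/v TT Tp tp dp Lp !opprD !opprK !cexpD.
rewrite -/P -/P' -/Q -/Q'; split; first by rewrite /v; ring.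
- transitivity (u ^+ 2 * (P * P) * (Q * Q') - v ^+ 2 * (P' * P') * (Q * Q')
     - u * v * (P * P') * (Q * Q - Q' * Q')).
    by rewrite QQ PP; ring.
  by rewrite /v; ring.
- transitivity (u ^+ 2 * (P * P) * (Q * Q') - v ^+ 2 * (P' * P') * (Q * Q')
     + u * v * (P * P') * (Q * Q - Q' * Q')).
    by rewrite QQ PP; ring.
  by rewrite /v; ring.
Qed.

Lemma coef_aE : coef_a k s d L kt =
  wave (u ^+ 2) (- v ^+ 2) z (2 * d) / coef_den k s d L kt.
Proof. by rewrite /coef_a /wave mulNr. Qed.

Lemma coef_bE : coef_b k s d L kt =
  - (u * v * wave 1 (- 1) z L / coef_den k s d L kt).
Proof.
rewrite /coef_b /wave; congr (- (_ / _)).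
by rewrite -/z /u /v subr_sqr; ring.
Qed.

Lemma coef_den_neq0 : coef_den k s d L kt != 0.
Proof.
have [-> _ _] := coef_factorizations.
by have [? ?] := wave_den_neq0; rewrite mulf_neq0.
Qed.

Lemma coef_a_neq0 : coef_a k s d L kt != 0.
Proof.
rewrite coef_aE mulf_neq0 ?invr_eq0 ?coef_den_neq0//.
rewrite wave_neq0 ?expf_neq0 ?mulr_gt0// normcN !expr2 !Normc.normcM.
by rewrite ler_pM ?normc_ge0.
Qed.

Lemma coef_b_neq0 : coef_b k s d L kt != 0.
Proof.
rewrite coef_bE oppr_eq0 mulf_neq0 ?invr_eq0 ?coef_den_neq0//.
by rewrite !mulf_neq0// wave_neq0 ?oner_neq0// normcN.
Qed.

Lemma coef_addE : coef_a k s d L kt + coef_b k s d L kt =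
  wave u (- v) z t / wave u (- v) z T.
Proof.
rewrite coef_aE coef_bE -mulrBl; have [-> -> _] := coef_factorizations.
by have [? ?] := wave_den_neq0; rewrite -mulf_div divff// mul1r.
Qed.

Lemma coef_subE : coef_a k s d L kt - coef_b k s d L kt =
  wave u v z t / wave u v z T.
Proof.
rewrite coef_aE coef_bE opprK -mulrDl; have [-> _ ->] := coef_factorizations.
by have [? ?] := wave_den_neq0; rewrite -mulf_div divff// mulr1.
Qed.

(** For positive parameters, the limit of the spectral radii of this mode. *)
Definition mode_factor : R :=
  Num.max (normc (coef_a k s d L kt + coef_b k s d L kt))
          (normc (coef_a k s d L kt - coef_b k s d L kt)).

Lemma mode_factor_lt (r : R) :
  normc (wave u v z t) < r * normc (wave u v z T) ->
  normc (wave u (- v) z t) < r * normc (wave u (- v) z T) ->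
  mode_factor < r.
Proof.
have [w1 w2] := wave_den_neq0.
rewrite /mode_factor coef_addE coef_subE !Normc.normcM !Normc.normcV.
rewrite gt_max => h1 h2; rewrite !ltr_pdivrMr ?h1 ?h2//.
all: by rewrite lt_neqAle eq_sym normc_eq0 normc_ge0 andbT.
Qed.

(** The difference of squared moduli in [wave_gap] is the right-hand side of
    [damped_gap] minus or plus the quantity under the absolute value. *)
Lemma mode_factor_lt1 : 0 < kt ->
  damped k s d L kt (complex.Re z) -> mode_factor < 1.
Proof.
move=> kt0; have [x [y [zE x0 y0 xy x2y2]]] := zetaP kt k0 s0.
rewrite /z zE => damp.
have := damped_gap k0 s0 d0 L0 kt0 x0 y0 xy x2y2 damp.
rewrite ltr_norml => /andP[lo hi].
have less (v' : R[i]) : v' = v \/ v' = - v ->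
    normc (wave u v' z t) < 1 * normc (wave u v' z T).
  move=> v'E; rewrite mul1r -ltr_sqr ?nnegrE ?normc_ge0// -subr_gt0.
  rewrite /u /v /z zE in v'E *; rewrite /alpha in v'E *.
  rewrite /= in v'E *.
  case: v'E => ->; simpc; rewrite wave_gap; lra.
by apply: mode_factor_lt; apply: less; [left|right].
Qed.

(** Crude bounds suffice for strongly decaying modes. Both [T - t = L] and
    [T + t = 2 d] are at least m, so the exponentials at t and - t are smaller
    than the one at T by a factor [exp (x m) >= 8]. *)
Lemma mode_factor_lt_half (m : R) : m <= L -> m <= 2 * d ->
  7 <= complex.Re z * m -> mode_factor < 2^-1.
Proof.
move=> mL m2d zm; have x0 := z0; set x := complex.Re z in x0 zm *.
have m0 : 0 < m by rewrite -(pmulr_rgt0 _ x0); lra.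
have e8 : 8 <= expR (x * m) by rewrite (le_trans _ (expR_ge1Dx _))//; lra.
set E := expR (x * T).
have u1 : 0 < normc u by rewrite lt_neqAle eq_sym normc_eq0 u0 normc_ge0.
have small (r : R) : r <= x * T - x * m -> expR r * 8 <= E.
  move=> rT; apply: (@le_trans _ _ (expR r * expR (x * m))).
    by rewrite ler_wpM2l ?expR_ge0.
  by rewrite -expRD ler_expR; lra.
have xmL : x * m <= x * L by rewrite ler_wpM2l// ltW.
have xmd : x * m <= x * (2 * d) by rewrite ler_wpM2l// ltW.
have tE : expR (x * t) * 8 <= E by apply: small; rewrite /t /T; lra.
have tNE : expR (- (x * t)) * 8 <= E by apply: small; rewrite /t /T; lra.
have TNE : expR (- (x * T)) * 8 <= E.
  apply: small; have : x * m <= x * T by rewrite /T; lra.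
  have : 0 < x * T by rewrite mulr_gt0.
  by lra.
have E0 : 0 < E by exact: expR_gt0.
have half (v' : R[i]) : normc v' <= normc u ->
    normc (wave u v' z t) < 2^-1 * normc (wave u v' z T).
  move=> v'u; have := wave_lower z T v'u; have := wave_upper z t v'u.
  rewrite -/x -/E => up lo.
  have h1 : normc u * (expR (x * t) + expR (- (x * t))) <= normc u * (E / 4).
    by rewrite ler_wpM2l ?(ltW u1)//; lra.
  have h2 : normc u * (7 / 8 * E) <= normc u * (E - expR (- (x * T))).
    by rewrite ler_wpM2l ?(ltW u1)//; lra.
  have h3 : 0 < normc u * E by rewrite mulr_gt0.
  by lra.
by apply: mode_factor_lt; apply: half; rewrite ?normcN.
Qed.

End ModeCoefficients.

Lemma rho1d_le_mode_factor (R : realType) (k s d L kt : R) N :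
  rho1d k s d L kt N <= mode_factor k s d L kt.
Proof.
rewrite /rho1d T1dE; apply: spectral_radius_le.
  by rewrite le_max normc_ge0.
by move=> l; exact: eigenvalue_toeplitz_le.
Qed.

Lemma cvg_rho1d (R : realType) (k s d L kt : R) :
  0 < k -> 0 < s -> 0 < d -> 0 < L ->
  rho1d k s d L kt @ \oo --> mode_factor k s d L kt.
Proof.
move=> k0 s0 d0 L0.
apply: cvg_spectral_radius_toeplitz; first exact: coef_a_neq0.
exact: coef_b_neq0.
Qed.

(** * Bounds over all modes *)

Lemma fourier_number_gt0 (R : realType) (Lhat : R) m :
  0 < Lhat -> (0 < m)%N -> 0 < fourier_number Lhat m.
Proof. by move=> L0 m0; rewrite divr_gt0// mulr_gt0 ?pi_gt0// ltr0n. Qed.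

Lemma R1dE (R : realType) (k s d L kt : R) :
  0 < k -> 0 < s -> 0 < d -> 0 < L ->
  R1d k s d L kt = mode_factor k s d L kt.
Proof. by move=> k0 s0 d0 L0; apply/cvg_lim => //; exact: cvg_rho1d. Qed.

(** From [x^2 = kt^2 - k^2 + y^2], a mode with [kt >= k + 7 / c] has
    [x >= 7 / c]. *)
Lemma high_modes_lt_half (R : realType) (k s d L Lhat : R) :
  0 < k -> 0 < s -> 0 < d -> 0 < L -> 0 < Lhat ->
  exists m1, forall m, (m1 <= m)%N ->
    mode_factor k s d L (fourier_number Lhat m) < 2^-1.
Proof.
move=> k0 s0 d0 L0 Lhat0.
pose c := Num.min L (2 * d).
have c0 : 0 < c by rewrite lt_min L0 mulr_gt0.
pose K := k + 7 / c.
exists (Num.truncn (K * Lhat / pi)).+1 => m m1m.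
have K0 : 0 < 7 / c by rewrite divr_gt0.
have ktK : K <= fourier_number Lhat m.
  rewrite /fourier_number ler_pdivlMr// -ler_pdivrMr ?pi_gt0//.
  by rewrite ltW// (lt_le_trans (truncnS_gt _))// ler_nat.
have [x [y [zE x0 y0 _ x2y2]]] := zetaP (fourier_number Lhat m) k0 s0.
apply: (@mode_factor_lt_half _ _ _ _ _ _ k0 s0 d0 L0 c).
- by rewrite ge_min lexx.
- by rewrite ge_min lexx orbT.
rewrite zE /= -ler_pdivrMr// -ler_sqr ?nnegrE ?(ltW K0) ?(ltW x0)//.
have : K ^+ 2 <= fourier_number Lhat m ^+ 2.
  have Kp : 0 < K by rewrite addr_gt0.
  by rewrite ler_sqr ?nnegrE ?(ltW Kp) ?(ltW (lt_le_trans Kp ktK)).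
have : 0 < k * (7 / c) by rewrite mulr_gt0.
have := sqr_ge0 y.
by move: x2y2; rewrite /K; lra.
Qed.

(** All but finitely many modes are below 1/2, and the others have a maximum. *)
Lemma R2d_lt1 (R : realType) (k s d L Lhat : R) :
  0 < k -> 0 < s -> 0 < d -> 0 < L -> 0 < Lhat ->
  (forall m, (0 < m)%N -> mode_factor k s d L (fourier_number Lhat m) < 1) ->
  (R2d k s d L Lhat < 1%:E)%E.
Proof.
move=> k0 s0 d0 L0 Lhat0 lt1.
pose F m := mode_factor k s d L (fourier_number Lhat m).
have [m1 high] := high_modes_lt_half k0 s0 d0 L0 Lhat0.
pose r := \big[Num.max/2^-1 : R]_(m < m1 | (0 < m)%N) F m.
have r1 : r < 1.
  rewrite /r; elim/big_ind: _ => [|x y|i i0]; first by lra.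
    by rewrite gt_max => -> ->.
  exact: lt1.
apply: (@le_lt_trans _ _ r%:E); last by rewrite lte_fin.
apply: ge_ereal_sup => _ [m /= m0 <-]; rewrite lee_fin R1dE//.
have [mm1|m1m] := ltnP m m1.
  by apply: (le_bigmax_cond _ (j := Ordinal mm1) (fun i : 'I_m1 => F i)).
by rewrite (le_trans (ltW (high _ m1m)))// /r bigmax_ge_id.
Qed.

(** If x were small, [y^2 = x^2 + k^2 - kt^2 <= 2 k^2] would make
    [2 x y = k s] impossible. *)
Lemma Re_zeta_ge (R : realType) (k s kt : R) :
  0 < k -> 0 < s -> s <= k -> s / 3 <= complex.Re (zeta k s kt).
Proof.
move=> k0 s0 sk; have [x [y [-> x0 y0 xy x2y2]]] := zetaP kt k0 s0.
rewrite /= leNgt; apply/negP => xs.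
have x2 : x ^+ 2 < s ^+ 2 / 9.
  have -> : s ^+ 2 / 9 = (s / 3) ^+ 2 by field.
  by rewrite ltr_sqr ?nnegrE ?divr_ge0 ?(ltW x0) ?(ltW s0).
have s2 : s ^+ 2 <= k ^+ 2 by rewrite ler_sqr ?nnegrE ?(ltW k0) ?(ltW s0).
have y2 : y ^+ 2 <= 2 * k ^+ 2 by have := sqr_ge0 kt; have := sqr_ge0 k; lra.
have : (2 * x * y) ^+ 2 = k ^+ 2 * s ^+ 2 by rewrite xy exprMn.
have p1 : x ^+ 2 * y ^+ 2 <= s ^+ 2 / 9 * (2 * k ^+ 2).
  by rewrite ler_pM ?sqr_ge0// ltW.
have : 0 < k ^+ 2 * s ^+ 2 by rewrite mulr_gt0 ?exprn_gt0.
by lra.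
Qed.

(** If [s < k], then x is at least [c = s0 / 3], and [2 x^2 L d >= 1] holds as
    soon as d or L exceeds a bound fixed by c and the lower bound on the other
    one; the three terms of M ensure that one of the cases occurs. *)
Lemma uniformly_damped (R : realType) (k s0 d0 L0 : R) :
  0 < k -> 0 < s0 -> 0 < d0 -> 0 < L0 ->
  exists M : R, forall s d L kt : R,
    s0 <= s -> d0 <= d -> L0 <= L -> M <= s + d + L ->
    damped k s d L kt (complex.Re (zeta k s kt)).
Proof.
move=> k0 s00 d00 L00; pose c := s0 / 3.
have c0 : 0 < c by rewrite divr_gt0.
exists (k + (2 * c ^+ 2 * L0)^-1 + (2 * c ^+ 2 * d0)^-1).
move=> s d L kt s0s d0d L0L ML.
have s_gt0 : 0 < s := lt_le_trans s00 s0s.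
have [ks|sk] := leP k s.
  left; have : k ^+ 2 <= s ^+ 2.
    by rewrite ler_sqr ?nnegrE ?(ltW k0) ?(ltW s_gt0).
  by have := sqr_ge0 kt; have := sqr_ge0 k; lra.
right; set x := complex.Re _.
have cx : c ^+ 2 <= x ^+ 2.
  have : c <= x.
    apply: le_trans (Re_zeta_ge kt k0 s_gt0 (ltW sk)).
    by rewrite ler_pM2r ?invr_gt0.
  by move=> cx; rewrite ler_sqr ?nnegrE ?(ltW c0) ?(ltW (lt_le_trans c0 cx)).
have c20 : 0 < 2 * c ^+ 2 by rewrite mulr_gt0// exprn_gt0.
have d_gt0 := lt_le_trans d00 d0d; have L_gt0 := lt_le_trans L00 L0L.
apply: (@le_trans _ _ (2 * c ^+ 2 * L * d)); last first.
  by rewrite !ler_wpM2r ?(ltW d_gt0) ?(ltW L_gt0)// ler_pM2l.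
have enough (f g f0 : R) : 0 < f0 -> f0 <= f -> (2 * c ^+ 2 * f0)^-1 <= g ->
    1 <= 2 * c ^+ 2 * f * g.
  move=> f00 f0f fg; have p0 : 0 < 2 * c ^+ 2 * f0 by rewrite mulr_gt0.
  rewrite -[leLHS](mulfV (lt0r_neq0 p0)) ler_pM ?invr_ge0 ?(ltW p0)//.
  by rewrite ler_wpM2l ?(ltW c20).
have [dL|dL] := leP (2 * c ^+ 2 * L0)^-1 d; first exact: (enough _ _ _ L00).
by rewrite mulrAC (enough _ _ _ d00)//; lra.
Qed.

Lemma absorbing_or_evanescent_damped (R : realType) (k s d L kt x : R) :
  0 < k -> 0 < s -> 0 < kt ->
  k <= s \/ k <= kt -> damped k s d L kt x.
Proof.
move=> k0 s0 kt0 H; left; have := sqr_ge0 s; have := sqr_ge0 kt.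
case: H => H.
  have : k ^+ 2 <= s ^+ 2 by rewrite ler_sqr ?nnegrE ?(ltW k0) ?(ltW s0).
  by lra.
have : k ^+ 2 <= kt ^+ 2 by rewrite ler_sqr ?nnegrE ?(ltW k0) ?(ltW kt0).
by lra.
Qed.

(** The supremum R2d itself is a uniform bound: R1d of a mode dominates its
    spectral radius for every number of subdomains. *)
Lemma R2d_lt1_scales (R : realType) (k s d L Lhat : R) :
  0 < k -> 0 < s -> 0 < d -> 0 < L ->
  (R2d k s d L Lhat < 1%:E)%E -> schwarz_scales k s d L Lhat.
Proof.
move=> k0 s0 d0 L0 lt1.
have ub m : (0 < m)%N ->
    ((mode_factor k s d L (fourier_number Lhat m))%:E <= R2d k s d L Lhat)%E.
  by move=> m0; rewrite -R1dE//; apply: ereal_sup_ubound; exists m.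
have R2d_fin : R2d k s d L Lhat \is a fin_num.
  rewrite fin_numE; apply/andP; split; last first.
    by rewrite lt_eqF// (lt_trans lt1)// ltry.
  by rewrite gt_eqF// (lt_le_trans _ (ub 1%N isT))// ltNyr.
exists (fine (R2d k s d L Lhat)); first by rewrite -lte_fin fineK.
exists 0%N => N m _ m0; rewrite (le_trans (rho1d_le_mode_factor _ _ _ _ _ _))//.
by rewrite -lee_fin fineK// ub.
Qed.

Theorem theorem4p6 (R : realType) (k Lhat : R) (hk : 0 < k) (hLhat : 0 < Lhat) :
  (* the limits defining R1d exist, for every mode *)
  (forall (sigma delta L : R) (m : nat),
     0 < sigma -> 0 < delta -> 0 < L -> (0 < m)%N ->
     cvgn (rho1d k sigma delta L (fourier_number Lhat m))) /\
  (* evanescent modes *)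
  (forall (sigma delta L : R) (m : nat),
     0 < sigma -> 0 < delta -> 0 < L -> (0 < m)%N ->
     k < fourier_number Lhat m ->
     R1d k sigma delta L (fourier_number Lhat m) < 1) /\
  (* sigma, delta and L sufficiently large between them: away from 0, it is
     enough that any one of the three be large *)
  (forall sigma0 delta0 L0 : R, 0 < sigma0 -> 0 < delta0 -> 0 < L0 ->
     exists M : R, forall sigma delta L : R,
       sigma0 <= sigma -> delta0 <= delta -> L0 <= L ->
       M <= sigma + delta + L ->
       (R2d k sigma delta L Lhat < 1%:E)%E) /\
  (* the case k <= sigma *)
  (forall sigma delta L : R, k <= sigma -> 0 < delta -> 0 < L ->
     (R2d k sigma delta L Lhat < 1%:E)%E) /\
  (* scaling *)
  (forall sigma delta L : R, 0 < sigma -> 0 < delta -> 0 < L ->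
     (R2d k sigma delta L Lhat < 1%:E)%E ->
     schwarz_scales k sigma delta L Lhat).
Proof.
have kt0 m : (0 < m)%N -> 0 < fourier_number Lhat m.
  exact: fourier_number_gt0.
split; [|split; [|split; [|split]]].
- by move=> s d L m s0 d0 L0 m0; apply/cvg_ex;
    exists (mode_factor k s d L (fourier_number Lhat m)); exact: cvg_rho1d.
- move=> s d L m s0 d0 L0 m0 evanescent; rewrite R1dE//.
  apply: mode_factor_lt1 => //; first exact: kt0.
  apply: absorbing_or_evanescent_damped => //; first exact: kt0.
  by right; exact: ltW.
- move=> s0 d0 L0 s00 d00 L00.
  have [M MP] := uniformly_damped hk s00 d00 L00.
  exists M => s d L s0s d0d L0L MsdL.
  have [s_gt0 d_gt0 L_gt0] : [/\ 0 < s, 0 < d & 0 < L].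
    by rewrite (lt_le_trans s00)// (lt_le_trans d00)// (lt_le_trans L00).
  apply: R2d_lt1 => // m m0; apply: mode_factor_lt1 => //; first exact: kt0.
  exact: MP.
- move=> s d L ks d0 L0; have s0 := lt_le_trans hk ks.
  apply: R2d_lt1 => // m m0; apply: mode_factor_lt1 => //; first exact: kt0.
  by apply: absorbing_or_evanescent_damped => //; [exact: kt0|left].
- by move=> s d L s0 d0 L0; exact: R2d_lt1_scales.
Qed.
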